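(* For any $n\ge3$ and any odd $k\ge3$, $$\mathrm{rank}_{\mathbf Z}(\mathrm{Im}(\mathrm{MT}_k^B))=\binom{n+k-1}{k}-\frac{n(n+1)}{2}.$$
   Context: Let $\mathcal L_n=\bigoplus_{k\ge1}\mathcal L_n(k)$ be the free Lie algebra over $\mathbf Z$ on the free abelian group $H$ with basis $x_1,\dots,x_n$, graded by weight, and let $x_1^*,\dots,x_n^*$ be the dual basis of $H^*$. Brackets $[a_1,\dots,a_k]$ are left-normed. For $k\ge1$, $\mathfrak p_n(k)$ is the $\mathbf Z$-submodule of $H^*\otimes_{\mathbf Z}\mathcal L_n(k+1)$ generated by all $x_i^*\otimes[x_{j_1},\dots,x_{j_k},x_i]$ with $1\le i,j_1,\dots,j_k\le n$, and $\mathfrak b_n(k)=\{\sum_i x_i^*\otimes C_i\in\mathfrak p_n(k)\mid\sum_iC_i=0\}$. Embed $\mathcal L_n(k+1)\subset H^{\otimes(k+1)}$ via $[a,b]=a\otimes b-b\otimes a$. The Morita trace $\mathrm{MT}_k:H^*\otimes\mathcal L_n(k+1)\to S^kH$ is the composite of this embedding, the contraction $x_i^*\otimes x_{j_1}\otimes\cdots\otimes x_{j_{k+1}}\mapsto x_i^*(x_{j_1})\,x_{j_2}\otimes\cdots\otimes x_{j_{k+1}}$, and the projection $H^{\otimes k}\to S^kH$; $\mathrm{MT}_k^B:\mathfrak b_n(k)\to S^kH$ is its restriction to $\mathfrak b_n(k)$. *)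

(* Defs.v *)
From HB Require Import structures.
From mathcomp Require Import all_boot all_order all_algebra.
From mathcomp Require Import boolp ssrAC.
From mathcomp Require Import finmap monalg.
From mathcomp Require Import mpoly.

Set Implicit Arguments.
Unset Strict Implicit.
Unset Printing Implicit Defensive.

Import GRing.Theory.
Local Open Scope ring_scope.
Local Open Scope quotient_scope.

Inductive zspan (V : zmodType) (S : V -> Prop) : V -> Prop :=
| zspan_gen v of S v : zspan S v
| zspan_0 : zspan S 0
| zspan_B u v of zspan S u & zspan S v : zspan S (u - v).

Definition zindep (V : zmodType) (r : nat) (v : 'I_r -> V) : Prop :=
  forall a : 'I_r -> int, \sum_(i < r) v i *~ a i = 0 -> forall i, a i = 0.

(* The rank of a subgroup [M] of [V] is the maximal number of Z-linearly
   independent elements of [M]. *)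
Definition has_zrank (V : zmodType) (M : V -> Prop) (r : nat) : Prop :=
  (exists2 v : 'I_r -> V, zindep v & forall i, M (v i)) /\
  (forall (s : nat) (v : 'I_s -> V),
     zindep v -> (forall i, M (v i)) -> (s <= r)%N).

Record is_lie_bracket (V : zmodType) (br : V -> V -> V) : Prop := {
  lie_brDl : forall u v w, br (u + v) w = br u w + br v w;
  lie_brDr : forall u v w, br u (v + w) = br u v + br u w;
  lie_brvv : forall u, br u u = 0;
  lie_jacobi : forall u v w,
    br (br u v) w + br (br v w) u + br (br w u) v = 0 }.

(* The free Lie algebra over Z: formal Lie expressions in n letters modulo the
   congruence generated by the axioms of abelian groups and [is_lie_bracket]. *)
Inductive lterm (n : nat) : Type :=
| LGen of 'I_n
| LZero
| LOpp of lterm n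
| LAdd of lterm n & lterm n
| LBr of lterm n & lterm n.
Arguments LZero {n}.

Inductive lcongr (n : nat) : lterm n -> lterm n -> Prop :=
| lc_refl a : lcongr a a
| lc_sym a b of lcongr a b : lcongr b a
| lc_trans a b c of lcongr a b & lcongr b c : lcongr a c
| lc_opp a a' of lcongr a a' : lcongr (LOpp a) (LOpp a')
| lc_add a a' b b' of lcongr a a' & lcongr b b' :
    lcongr (LAdd a b) (LAdd a' b')
| lc_br a a' b b' of lcongr a a' & lcongr b b' : lcongr (LBr a b) (LBr a' b')
| lc_addA a b c : lcongr (LAdd a (LAdd b c)) (LAdd (LAdd a b) c)
| lc_addC a b : lcongr (LAdd a b) (LAdd b a)
| lc_add0 a : lcongr (LAdd LZero a) a
| lc_addN a : lcongr (LAdd (LOpp a) a) LZero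
| lc_brDl a b c : lcongr (LBr (LAdd a b) c) (LAdd (LBr a c) (LBr b c))
| lc_brDr a b c : lcongr (LBr a (LAdd b c)) (LAdd (LBr a b) (LBr a c))
| lc_brvv a : lcongr (LBr a a) LZero
| lc_jacobi a b c :
    lcongr (LAdd (LAdd (LBr (LBr a b) c) (LBr (LBr b c) a)) (LBr (LBr c a) b))
           LZero.

HB.instance Definition _ (n : nat) := gen_eqMixin (lterm n).
HB.instance Definition _ (n : nat) := gen_choiceMixin (lterm n).

Section FreeLie.
Variable n : nat.

Definition lcongrb (a b : lterm n) : bool := `[< lcongr a b >].

Lemma lcongrb_equiv : equiv_class_of lcongrb.
Proof.
split=> [a|a b|b a c].
- by apply/asboolP; exact: lc_refl.
- by apply/asboolP/asboolP; exact: lc_sym.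
- by move=> /asboolP ab /asboolP bc; apply/asboolP; exact: lc_trans ab bc.
Qed.

Canonical lcongr_equivRel := EquivRelPack lcongrb_equiv.

Definition free_lie : Type := {eq_quot lcongr_equivRel}.
HB.instance Definition _ := Choice.on free_lie.
HB.instance Definition _ := EqQuotient.on free_lie.

Definition flgen (i : 'I_n) : free_lie := \pi_free_lie (LGen i).
Definition flzero : free_lie := \pi_free_lie LZero.
Definition flopp (u : free_lie) : free_lie := \pi_free_lie (LOpp (repr u)).
Definition fladd (u v : free_lie) : free_lie :=
  \pi_free_lie (LAdd (repr u) (repr v)).
Definition flbr (u v : free_lie) : free_lie :=
  \pi_free_lie (LBr (repr u) (repr v)).

Lemma fl_piP (a b : lterm n) :
  (\pi_free_lie a = \pi_free_lie b) <-> lcongr a b.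
Proof.
split=> [/eqP|ab]; first by rewrite eqmodE => /asboolP.
by apply/eqP; rewrite eqmodE; apply/asboolP.
Qed.

Lemma fl_reprK (a : lterm n) : lcongr (repr (\pi_free_lie a)) a.
Proof. by apply/fl_piP; rewrite reprK. Qed.

Lemma flopp_pi a : flopp (\pi_free_lie a) = \pi_free_lie (LOpp a).
Proof. by apply/fl_piP/lc_opp/fl_reprK. Qed.

Lemma fladd_pi a b :
  fladd (\pi_free_lie a) (\pi_free_lie b) = \pi_free_lie (LAdd a b).
Proof. by apply/fl_piP/lc_add; exact: fl_reprK. Qed.

Lemma flbr_pi a b :
  flbr (\pi_free_lie a) (\pi_free_lie b) = \pi_free_lie (LBr a b).
Proof. by apply/fl_piP/lc_br; exact: fl_reprK. Qed.

Lemma fladdA : associative fladd.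
Proof.
elim/quotW=> a; elim/quotW=> b; elim/quotW=> c.
by rewrite (fladd_pi b c) (fladd_pi a b) !fladd_pi; apply/fl_piP; exact: lc_addA.
Qed.

Lemma fladdC : commutative fladd.
Proof.
by elim/quotW=> a; elim/quotW=> b; rewrite !fladd_pi; apply/fl_piP; exact: lc_addC.
Qed.

Lemma fladd0 : left_id flzero fladd.
Proof. by elim/quotW=> a; rewrite fladd_pi; apply/fl_piP; exact: lc_add0. Qed.

Lemma fladdN : left_inverse flzero flopp fladd.
Proof.
by elim/quotW=> a; rewrite flopp_pi fladd_pi; apply/fl_piP; exact: lc_addN.
Qed.

HB.instance Definition _ :=
  GRing.isZmodule.Build free_lie fladdA fladdC fladd0 fladdN.

Lemma pi_LAdd a b :
  \pi_free_lie (LAdd a b) = \pi_free_lie a + \pi_free_lie b.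
Proof. by rewrite -fladd_pi. Qed.

Lemma pi_LOpp a : \pi_free_lie (LOpp a) = - \pi_free_lie a.
Proof. by rewrite -flopp_pi. Qed.

Lemma flbr_is_lie : is_lie_bracket flbr.
Proof.
split.
- elim/quotW=> a; elim/quotW=> b; elim/quotW=> c.
  rewrite (flbr_pi a c) (flbr_pi b c) -!pi_LAdd flbr_pi.
  by apply/fl_piP; exact: lc_brDl.
- elim/quotW=> a; elim/quotW=> b; elim/quotW=> c.
  rewrite (flbr_pi a b) (flbr_pi a c) -!pi_LAdd flbr_pi.
  by apply/fl_piP; exact: lc_brDr.
- by elim/quotW=> a; rewrite flbr_pi; apply/fl_piP; exact: lc_brvv.
- elim/quotW=> a; elim/quotW=> b; elim/quotW=> c.
  rewrite (flbr_pi a b) (flbr_pi b c) (flbr_pi c a).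
  rewrite (flbr_pi _ a) (flbr_pi _ b) (flbr_pi _ c).
  rewrite -(pi_LAdd (LBr (LBr a b) c) (LBr (LBr b c) a)) -pi_LAdd.
  by apply/fl_piP; exact: lc_jacobi.
Qed.

(* [flift br f] is the morphism of Lie algebras from [free_lie] to [(V, br)]
   extending [f]; [flift_unique] is the universal property. *)
Section Lift.
Variables (V : zmodType) (br : V -> V -> V) (f : 'I_n -> V).

Fixpoint leval (a : lterm n) : V :=
  match a with
  | LGen i => f i
  | LZero => 0
  | LOpp a => - leval a
  | LAdd a b => leval a + leval b
  | LBr a b => br (leval a) (leval b)
  end.

Definition flift (u : free_lie) : V := leval (repr u).

Hypothesis brP : is_lie_bracket br.

Lemma leval_congr a b : lcongr a b -> leval a = leval b.
Proof.
elim=> //=.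
- by move=> {}a {}b c _ -> _ ->.
- by move=> {}a a' _ ->.
- by move=> {}a a' {}b b' _ -> _ ->.
- by move=> {}a a' {}b b' _ -> _ ->.
- by move=> *; rewrite addrA.
- by move=> *; rewrite addrC.
- by move=> *; rewrite add0r.
- by move=> *; rewrite addNr.
- by move=> *; rewrite (lie_brDl brP).
- by move=> *; rewrite (lie_brDr brP).
- by move=> *; rewrite (lie_brvv brP).
- by move=> *; rewrite (lie_jacobi brP).
Qed.

Lemma flift_pi a : flift (\pi_free_lie a) = leval a.
Proof. exact/leval_congr/fl_reprK. Qed.

Lemma flift_gen i : flift (flgen i) = f i.
Proof. by rewrite flift_pi. Qed.

Lemma fliftB : {morph flift : u v / u - v}.
Proof.
by elim/quotW=> a; elim/quotW=> b; rewrite -pi_LOpp -pi_LAdd !flift_pi.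
Qed.

Lemma flift_br u v : flift (flbr u v) = br (flift u) (flift v).
Proof.
by elim/quotW: u => a; elim/quotW: v => b; rewrite flbr_pi !flift_pi.
Qed.

Lemma flift_unique (g : free_lie -> V) :
  (forall i, g (flgen i) = f i) -> {morph g : u v / u - v} ->
  {morph g : u v / flbr u v >-> br u v} -> g =1 flift.
Proof.
move=> gx gB gbr; elim/quotW=> a; rewrite flift_pi.
have g0 : g 0 = 0 by rewrite -[X in g X](subrr (0 : free_lie)) gB subrr.
have gN u : g (- u) = - g u by rewrite -[in LHS](sub0r u) gB g0 sub0r.
elim: a => [i||a IH|a IHa b IHb|a IHa b IHb] /=.
- exact: gx.
- exact: g0.
- by rewrite pi_LOpp gN IH.
- by rewrite pi_LAdd -[\pi b]opprK gB gN opprK IHa IHb.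
- by rewrite -flbr_pi gbr IHa IHb.
Qed.

End Lift.
End FreeLie.

Definition lbracket (n : nat) (s : seq (free_lie n)) : free_lie n :=
  if s is u :: s' then foldl (@flbr n) u s' else 0.

(* The tensor algebra of H is the algebra of the free monoid on 'I_n: the word
   [:: j_1; ...; j_m] stands for the tensor x_{j_1} (x) ... (x) x_{j_m}. *)
Notation tensalg n := {malg int[{fmonom 'I_n}]}.

Definition word (n : nat) (s : seq 'I_n) : tensalg n :=
  monalg.mkmalgU (FMonom s) 1.

Definition commutator (R : nzRingType) (a b : R) : R := a * b - b * a.

Lemma commutator_is_lie (R : nzRingType) : is_lie_bracket (@commutator R).
Proof.
rewrite /commutator; split=> [u v w|u v w|u|u v w].
- by rewrite mulrDl mulrDr opprD addrACA.
- by rewrite mulrDl mulrDr opprD addrACA.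
- by rewrite subrr.
- rewrite !mulrBl !mulrBr !mulrA !opprB.
  have cancel3 (V : zmodType) (a b c d e f : V) :
    a - b + (c - d) + (e - c + (f - a)) + (d - f + (b - e)) = 0.
    rewrite !addrA (ACl ((1*8)*(2*11)*(3*6)*(4*9)*(5*12)*(7*10)))%AC /=.
    by rewrite !(subrr, addNr, addr0).
  exact: cancel3.
Qed.

Definition embed (n : nat) : free_lie n -> tensalg n :=
  flift (@commutator (tensalg n)) (fun i => word [:: i]).

(* The Z-linear extension of [h] from words, a basis of the tensor algebra. *)
Definition word_ext (n : nat) (V : zmodType) (h : seq 'I_n -> V)
    (t : tensalg n) : V :=
  \sum_(w <- monalg.msupp t) h w *~ monalg.mcoeff w t.

Definition contract (n : nat) (i : 'I_n) : tensalg n -> tensalg n :=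
  word_ext (fun w => if w is j :: w' then word w' *+ (j == i) else 0).

(* The symmetric algebra of H: S^k H is the component of degree k and 'X_i
   stands for x_i. The notation {mpoly int[n]} is avoided here because monalg.v uses it for another type. *)
Notation symalg n := (mpoly.mpoly n int).

Definition symproj (n : nat) : tensalg n -> symalg n :=
  word_ext (fun w => \prod_(j <- w) 'X_j).

(* H^* (x) L_n is the group of families: c stands for sum_i x_i^* (x) c_i. *)
Notation dual_lie n := {ffun 'I_n -> free_lie n}.

Definition pure_tensor (n : nat) (i : 'I_n) (u : free_lie n) : dual_lie n :=
  [ffun l => if l == i then u else 0].

(* Left-normed brackets of weight k span the component L_n(k). *)
Definition lie_weight (n k : nat) : free_lie n -> Prop :=
  zspan (fun u => exists j : k.-tuple 'I_n, u = lbracket (map (@flgen n) j)).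

Definition p_mod (n k : nat) : dual_lie n -> Prop :=
  zspan (fun c => exists (i : 'I_n) (j : k.-tuple 'I_n),
    c = pure_tensor i (lbracket (map (@flgen n) (rcons j i)))).

Lemma p_mod_weight (n k : nat) (c : dual_lie n) :
  p_mod k c -> forall i, lie_weight k.+1 (c i).
Proof.
move=> pc l; elim: c / pc => [c [i [j ->]]||c d _ IHc _ IHd].
- rewrite ffunE; case: eqP => _; last exact: zspan_0.
  by apply: zspan_gen; exists [tuple of rcons j i].
- by rewrite ffunE; exact: zspan_0.
- by rewrite !ffunE; exact: zspan_B.
Qed.

Definition b_mod (n k : nat) (c : dual_lie n) : Prop :=
  p_mod k c /\ \sum_(i < n) c i = 0.

(* Defined on all of H^* (x) L_n; its restriction to weight k + 1 is MT_k. *)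
Definition morita_trace (n : nat) (c : dual_lie n) : symalg n :=
  \sum_(i < n) symproj (contract i (embed (c i))).

Definition image_MTB (n k : nat) (q : symalg n) : Prop :=
  exists2 c : dual_lie n, b_mod k c & q = morita_trace c.

(* Main.v *)
Require Import Defs.
From mathcomp Require Import all_boot all_order all_algebra.
From mathcomp Require Import boolp finmap monalg mpoly ring zify.

Set Implicit Arguments.
Unset Strict Implicit.
Unset Printing Implicit Defensive.
Import Order.TTheory GRing.Theory Num.Theory.
Local Open Scope ring_scope.

(** Write M for the image of MT_k^B in S^k H. The proof traps M between two
    groups of the same rank.

    The trace is computed by a two-dimensional affine Lie algebra. For a
    commutative ring R, let [(p, s), (p', s')] = (p s' - p' s, 0) on R * R.
    Embedding a Lie element u in the tensor algebra, contracting it with x_i^*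
    and projecting to the symmetric algebra yields the first component of the
    image of u under the Lie morphism x_j |-> (delta_ij, x_j)
    ([symproj_contract_embed]). The second component, the symmetrization of u,
    vanishes on brackets, so traces of left-normed brackets are products.

    Upper bound. For a <= b let xi_ab be the point e_b if a = b, and e_b - e_a
    otherwise. Then q(xi_ab) = 0 for every q in M. Indeed the value at xi of
    the trace of x_i^* (x) [u, x_i] is xi_i times the first component of u
    under x_j |-> (delta_ij, xi_j), and on brackets this component depends on
    (delta_ij)_j only modulo multiples of xi. For xi = xi_ab the two vectors
    delta_a and delta_b agree modulo xi, and xi_i = 0 for every other i, so a
    single morphism serves for all i: q(xi_ab) is the value of one functional
    at the sum of the C_i, which is zero ([image_MTB_pair_point]). There are
    n(n+1)/2 such points, and these conditions determine the coefficients of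
    the pivots x_a^(k-1) x_b, a <= b, from all the other ones
    ([pivot_in_image_eq0]).

    Lower bound. A trivalent tree with k + 1 leaves labelled by letters defines
    an element of b_n(k): sum over the leaves l the terms
    x_l^* (x) [T_l, x_l], where T_l is the tree rooted at l; the C_i then add
    up to zero by antisymmetry and the Jacobi identity ([b_mod_caterpillar]).
    In the trace of a caterpillar only pairs of leaves at opposite ends
    survive, and reversing the caterpillar multiplies their contribution by
    (-1)^(k-1). For k odd the two directions therefore add up: M contains
    2 x_a x_b x_c m for distinct a, b, c and 2 (x_a x_b^2 + x_a^2 x_b) m for
    a <> b, m being any monomial of degree k - 3. Telescoping the second
    family, M contains for each monomial m that is not a pivot an element equal
    to 2 m up to pivots ([image_MTB_twice_monomial]).

    Hence the coefficients at the monomials of degree k that are not pivots are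
    coordinates on M in the sense of [has_zrank_coordinates], and it remains to
    count these monomials. *)

(** * Subgroups, Lie brackets and ranks *)

Section Subgroup.
Variables (V : zmodType) (M : V -> Prop).
Hypotheses (M0 : M 0) (MB : forall u v, M u -> M v -> M (u - v)).

Lemma subgroupN v : M v -> M (- v).
Proof. by move=> Mv; rewrite -sub0r; exact: MB. Qed.

Lemma subgroupD u v : M u -> M v -> M (u + v).
Proof. by move=> Mu Mv; rewrite -[v]opprK; apply/MB/subgroupN. Qed.

Lemma subgroupMz v (z : int) : M v -> M (v *~ z).
Proof.
move=> Mv; have MMn m : M (v *+ m).
  by elim: m => [|m IH]; rewrite ?mulr0n // mulrS; exact: subgroupD.
by case: z => m; rewrite ?NegzE ?mulrNz -?pmulrn; [|apply: subgroupN].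
Qed.

End Subgroup.

Lemma zspanD (V : zmodType) (S : V -> Prop) u v :
  zspan S u -> zspan S v -> zspan S (u + v).
Proof. exact: subgroupD (zspan_0 S) (@zspan_B V S) u v. Qed.

Section LieBracket.
Variables (V : zmodType) (br : V -> V -> V).
Hypothesis brP : is_lie_bracket br.

Lemma lie_br0r u : br u 0 = 0.
Proof. by apply: (addrI (br u 0)); rewrite -(lie_brDr brP) !addr0. Qed.

Lemma lie_br0l u : br 0 u = 0.
Proof. by apply: (addrI (br 0 u)); rewrite -(lie_brDl brP) !addr0. Qed.

Lemma lie_brBr u v w : br u (v - w) = br u v - br u w.
Proof. by apply/eqP; rewrite eq_sym subr_eq -(lie_brDr brP) subrK. Qed.

Lemma lie_brBl u v w : br (u - v) w = br u w - br v w.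
Proof. by apply/eqP; rewrite eq_sym subr_eq -(lie_brDl brP) subrK. Qed.

Lemma lie_brC u v : br u v = - br v u.
Proof.
have := lie_brvv brP (u + v).
rewrite (lie_brDl brP) !(lie_brDr brP) !(lie_brvv brP) add0r addr0.
by move/eqP; rewrite addr_eq0 => /eqP.
Qed.

Lemma lie_br_derivation u v w : br u (br v w) = br (br u v) w - br (br u w) v.
Proof.
have /eqP := lie_jacobi brP u v w.
rewrite -addrA addr_eq0 (lie_brC w u) -[- br u w]sub0r lie_brBl lie_br0l sub0r.
by move=> /eqP ->; rewrite (lie_brC u (br v w)) opprD opprK addrK.
Qed.

End LieBracket.

(** A rational relation between the rows exists for reasons of dimension; its
    denominators are cleared by reading it as a polynomial. *)
Lemma int_left_kernel s r (A : 'M[int]_(s, r)) : (r < s)%N ->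
  exists2 x : 'rV[int]_s, x != 0 & x *m A = 0.
Proof.
move=> ltrs; pose Aq : 'M[rat]_(s, r) := map_mx intr A.
have kerN0 : kermx Aq != 0.
  rewrite kermx_eq0 /row_free neq_ltn; apply/orP; left.
  exact: leq_ltn_trans (rank_leq_col _) ltrs.
have [i xi] : exists i, row i (kermx Aq) != 0.
  apply/existsP; rewrite -negb_forall; apply: contra kerN0 => /forallP r0.
  by apply/eqP/row_matrixP => i; rewrite row0; apply/eqP/r0.
set x := row i _ in xi.
have xA : x *m Aq = 0 by rewrite -row_mul mulmx_ker row0.
have [q [d d0 xq]] := rat_poly_scale (rVpoly x).
have qx (j : 'I_s) : (q`_j)%:~R = d%:~R * x 0 j.
  have := congr1 (fun p : {poly rat} => p`_j) xq.
  rewrite coef_rVpoly_ord coefZ coef_map /= => ->.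
  by rewrite mulVKf // intr_eq0.
exists (\row_j q`_j).
  apply: contra xi => /eqP/rowP y0; apply/eqP/rowP => j.
  have := qx j; have := y0 j; rewrite !mxE => -> /eqP.
  by rewrite eq_sym mulf_eq0 intr_eq0 (negbTE d0) => /eqP.
apply/rowP => j; have /rowP/(_ j) := xA; rewrite !mxE => xAj.
apply/eqP; rewrite -(intr_eq0 rat) rmorph_sum /=.
under eq_bigr => l _ do rewrite rmorphM /= mxE qx -mulrA.
rewrite -mulr_sumr; apply/eqP; rewrite [X in _ * X](_ : _ = 0) ?mulr0 //.
by rewrite -[RHS]xAj; apply: eq_bigr => l _; rewrite !mxE.
Qed.

(** The coordinates embed [M] in Z^r, and the image contains a nonzero multiple
    of each basis vector, hence has finite index. *)
Lemma has_zrank_coordinates (V : zmodType) (M : V -> Prop) (r : nat)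
    (coord : 'I_r -> {additive V -> int}) :
  M 0 -> (forall u v, M u -> M v -> M (u - v)) ->
  (forall v, M v -> (forall i, coord i v = 0) -> v = 0) ->
  (forall i, exists2 v, M v &
     coord i v != 0 /\ forall j, j != i -> coord j v = 0) ->
  has_zrank M r.
Proof.
move=> M0 MB cinj cdual.
have coordMz i v (z : int) : coord i (v *~ z) = coord i v * z.
  by rewrite raddfMz -mulrzr intz.
split.
  have [v Mv] := choice (fun i => let: ex_intro2 v Mv cv := cdual i in
    ex_intro (fun v => M v /\ (coord i v != 0 /\
       forall j, j != i -> coord j v = 0)) v (conj Mv cv)).
  exists v => [a av i|i]; last by have [] := Mv i.
  have := congr1 (coord i) av.
  rewrite raddf_sum raddf0 (bigD1 i) //= big1 ?addr0 => [|j ji].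
    rewrite coordMz => /eqP; rewrite mulf_eq0 => /orP[|/eqP//].
    by have [_ [/negbTE->]] := Mv i.
  by rewrite coordMz; have [_ [_ ->]] := Mv j; rewrite ?mul0r // eq_sym.
move=> s v vind Mv; rewrite leqNgt; apply/negP => rs.
have [x x0 xA] := int_left_kernel (\matrix_(i, j) coord j (v i)) rs.
move/eqP: x0; apply; apply/rowP => i; rewrite mxE.
apply: (vind (fun i => x 0 i)); apply: cinj.
  apply: (big_ind M) => // [u w|j _]; first exact: subgroupD.
  exact: subgroupMz.
move=> j; rewrite raddf_sum; have /rowP/(_ j) := xA; rewrite !mxE => xAj.
by rewrite -[RHS]xAj; apply: eq_bigr => l _; rewrite coordMz mxE mulrC.
Qed.

(** * The tensor algebra and the contraction *)

Lemma commutator_eq0 (A : nzRingType) (R : comNzRingType) (f : A -> R) x y :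
  {morph f : a b / a - b} -> {morph f : a b / a * b} ->
  f (commutator x y) = 0.
Proof. by move=> fB fM; rewrite /commutator fB !fM mulrC subrr. Qed.

(** Removing a given first letter is a Fox derivative, that is, it satisfies
    c(x y) = c(x) y + e(x) c(y) with e the augmentation. This is bilinear in x
    and y, so it has to be checked on additive generators only; and it becomes
    a plain derivation, up to order, where e vanishes. *)
Section FoxDerivative.
Variables (A : nzRingType) (c : A -> A) (e : A -> int).
Hypotheses (cB : {morph c : x y / x - y}) (eB : {morph e : x y / x - y}).

Lemma fox_derivative_ext (W : A -> Prop) :
  (forall Q : A -> Prop, (forall w, W w -> Q w) ->
     (forall x y, Q x -> Q y -> Q (x - y)) -> forall x, Q x) ->
  (forall x y, W x -> W y -> c (x * y) = c x * y + c y *~ e x) ->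
  forall x y, c (x * y) = c x * y + c y *~ e x.
Proof.
move=> Wind cM x y; elim/Wind: x => [x Wx|x1 x2 IH1 IH2]; last first.
  by rewrite mulrBl !cB IH1 IH2 eB mulrzBr [in RHS]mulrBl opprD addrACA.
elim/Wind: y => [y Wy|y1 y2 IH1 IH2]; last first.
  by rewrite mulrBr !cB IH1 IH2 mulrzBl [in RHS]mulrBr opprD addrACA.
exact: cM.
Qed.

Lemma fox_derivative_commutator (R : comNzRingType) (p : A -> R) x y :
  {morph p : a b / a - b} -> {morph p : a b / a * b} ->
  (forall a b, c (a * b) = c a * b + c b *~ e a) -> e x = 0 -> e y = 0 ->
  p (c (commutator x y)) = p (c x) * p y - p (c y) * p x.
Proof.
move=> pB pM cM ex ey.
by rewrite /commutator cB !cM ex ey !mulr0z !addr0 pB !pM.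
Qed.

End FoxDerivative.

Section TensorAlgebra.
Variable n : nat.
Implicit Types (u v : free_lie n) (t : tensalg n) (w : seq 'I_n) (i : 'I_n).

Section WordExt.
Variable (V : zmodType) (h : seq 'I_n -> V).

Lemma word_extEw t (d : {fset {fmonom 'I_n}}) :
  (monalg.msupp t `<=` d)%fset ->
  word_ext h t = \sum_(w <- d) h w *~ monalg.mcoeff w t.
Proof.
move=> le; rewrite /word_ext (big_fset_incl _ le) // => w _ wN.
by rewrite monalg.mcoeff_outdom // mulr0z.
Qed.

Lemma word_extB : {morph word_ext h : t1 t2 / t1 - t2}.
Proof.
move=> t1 t2.
set d := (monalg.msupp t1 `|` monalg.msupp t2)%fset.
rewrite (@word_extEw t1 d) ?fsubsetUl // (@word_extEw t2 d) ?fsubsetUr //.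
rewrite (@word_extEw _ d) ?monalg.msuppB_le // -sumrB.
by apply: eq_bigr => w _; rewrite raddfB mulrzBr.
Qed.

Lemma word_ext_word w : word_ext h (word w) = h w.
Proof.
rewrite /word_ext /word monalg.msuppU1 big_seq_fset1 monalg.mcoeffUU.
by rewrite mulr1z.
Qed.

End WordExt.

Lemma word_ind (Q : tensalg n -> Prop) :
  (forall w, Q (word w)) -> (forall t1 t2, Q t1 -> Q t2 -> Q (t1 - t2)) ->
  forall t, Q t.
Proof.
move=> Qw QB t.
have Q0 : Q 0 by rewrite -(subrr (word [::])); apply: QB.
rewrite (monalg.monalgE t); apply: (big_ind Q) => // [t1 t2|w _].
  exact: subgroupD.
have -> : monalg.mkmalgU w (monalg.mcoeff w t) = word w *~ monalg.mcoeff w t.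
  by case: w => w; rewrite /word -raddfMz /= intz.
exact: subgroupMz.
Qed.

Lemma wordM w1 w2 : word w1 * word w2 = word (w1 ++ w2) :> tensalg n.
Proof.
rewrite monalg.malgM_def /word monalg.fgmulUU mulr1.
by congr (monalg.mkmalgU _ _); exact: fmmulE.
Qed.

Lemma word_extM (R : comNzRingType) (h : seq 'I_n -> R) :
  {morph h : w1 w2 / w1 ++ w2 >-> w1 * w2} ->
  {morph word_ext h : t1 t2 / t1 * t2}.
Proof.
move=> hM; have extB := word_extB h.
elim/word_ind=> [w1|s1 s2 IH1 IH2] t2; last first.
  by rewrite extB [RHS]mulrBl -IH1 -IH2 -extB mulrBl.
elim/word_ind: t2 => [w2|s1 s2 IH1 IH2]; last first.
  by rewrite extB [RHS]mulrBr -IH1 -IH2 -extB mulrBr.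
by rewrite wordM !word_ext_word hM.
Qed.

Lemma symprojB : {morph @symproj n : t1 t2 / t1 - t2}.
Proof. exact: word_extB. Qed.

Lemma symprojM : {morph @symproj n : t1 t2 / t1 * t2}.
Proof. by apply: word_extM => w1 w2; rewrite big_cat. Qed.

Lemma contractB i : {morph contract i : t1 t2 / t1 - t2}.
Proof. exact: word_extB. Qed.

Lemma embed_gen i : embed (flgen i) = word [:: i].
Proof. exact/flift_gen/commutator_is_lie. Qed.

Lemma embedB : {morph @embed n : u v / u - v}.
Proof. exact/fliftB/commutator_is_lie. Qed.

Lemma embed_br : {morph @embed n : u v / flbr u v >-> commutator u v}.
Proof. exact/flift_br/commutator_is_lie. Qed.

Definition augment : tensalg n -> int := word_ext (fun w => (w == [::])%:R).

Lemma augmentB : {morph augment : t1 t2 / t1 - t2}.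
Proof. exact: word_extB. Qed.

Lemma augmentM : {morph augment : t1 t2 / t1 * t2}.
Proof. by apply: word_extM => -[|? ?] [|? ?]. Qed.

Lemma augment_embed u : augment (embed u) = 0.
Proof.
pose br0 (_ _ : int) : int := 0.
have br0P : is_lie_bracket br0 by split=> *; rewrite /br0 ?addr0.
have augE : (fun v => augment (embed v)) =1 flift br0 (fun=> 0).
  apply: flift_unique => // [i|v w|v w].
  - by rewrite embed_gen /augment word_ext_word.
  - by rewrite embedB /augment word_extB.
  - by rewrite embed_br (commutator_eq0 _ _ augmentB augmentM).
rewrite augE; apply/esym.
by apply: (@flift_unique _ _ _ _ br0P (fun=> 0)) => // *; rewrite subrr.
Qed.

Lemma contractM i t1 t2 :
  contract i (t1 * t2) = contract i t1 * t2 + contract i t2 *~ augment t1.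
Proof.
apply: (@fox_derivative_ext _ _ _ (contractB i) augmentB
          (fun t => exists w, t = word w)).
  by move=> Q Qw QB; apply: word_ind => // w; apply: Qw; exists w.
move=> _ _ [w1 ->] [w2 ->]; rewrite wordM /contract /augment !word_ext_word.
case: w1 => [|j w1] /=; first by rewrite mul0r add0r mulr1z.
by rewrite mulr0z addr0 -wordM mulrnAl.
Qed.

End TensorAlgebra.

(** * The affine Lie algebra and the trace *)

Section AffineBracket.
Variable R : comNzRingType.

Definition aff_br (u v : R * R) : R * R := (u.1 * v.2 - v.1 * u.2, 0).

Lemma aff_br_is_lie : is_lie_bracket aff_br.
Proof.
split=> [[a b] [c d] [e f]|[a b] [c d] [e f]|[a b]|[a b] [c d] [e f]].
- by apply/eqP; rewrite xpair_eqE /= addr0 eqxx andbT; apply/eqP; ring.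
- by apply/eqP; rewrite xpair_eqE /= addr0 eqxx andbT; apply/eqP; ring.
- by rewrite /aff_br /= subrr.
- by apply/eqP; rewrite xpair_eqE /= !addr0 eqxx andbT; apply/eqP; ring.
Qed.

End AffineBracket.

Section AffineMorphism.
Variable n : nat.
Implicit Types (u v w : free_lie n) (i j : 'I_n).

Definition aff_eval (R : comNzRingType) (f xi : 'I_n -> R) :
    free_lie n -> R * R :=
  flift (@aff_br R) (fun j => (f j, xi j)).

Section FixedRing.
Variable R : comNzRingType.
Implicit Types f xi : 'I_n -> R.

Lemma aff_eval_gen f xi j : aff_eval f xi (flgen j) = (f j, xi j).
Proof. exact/flift_gen/aff_br_is_lie. Qed.

Lemma aff_evalB f xi : {morph aff_eval f xi : u v / u - v}.
Proof. exact/fliftB/aff_br_is_lie. Qed.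

Lemma aff_eval0 f xi : aff_eval f xi 0 = 0.
Proof. by rewrite -(subrr 0) aff_evalB subrr. Qed.

Lemma aff_eval_br f xi u v :
  aff_eval f xi (flbr u v) = aff_br (aff_eval f xi u) (aff_eval f xi v).
Proof. exact/flift_br/aff_br_is_lie. Qed.

Lemma aff_eval_unique f xi (g : free_lie n -> R * R) :
  (forall j, g (flgen j) = (f j, xi j)) -> {morph g : u v / u - v} ->
  {morph g : u v / flbr u v >-> aff_br u v} -> g =1 aff_eval f xi.
Proof. exact/flift_unique/aff_br_is_lie. Qed.

(** The shear (p, s) |-> (p + c s, s) is an automorphism of the affine Lie
    algebra. On brackets, where the second component vanishes, the first one
    thus depends on [f] only modulo multiples of [xi]. *)
Lemma aff_eval_shear f xi (c : R) u :
  (aff_eval (fun j => f j + c * xi j) xi u).1 =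
  (aff_eval f xi u).1 + c * (aff_eval f xi u).2.
Proof.
pose g v := ((aff_eval f xi v).1 + c * (aff_eval f xi v).2,
             (aff_eval f xi v).2).
rewrite -(@aff_eval_unique _ _ g) // => [j|v w|v w]; rewrite /g.
- by rewrite aff_eval_gen.
- rewrite aff_evalB; apply/eqP; rewrite xpair_eqE /= eqxx andbT.
  by apply/eqP; ring.
- rewrite aff_eval_br; apply/eqP; rewrite xpair_eqE /= eqxx andbT.
  by apply/eqP; ring.
Qed.

End FixedRing.

Lemma aff_eval_rmorph (R S : comNzRingType) (phi : {rmorphism R -> S})
    (f xi : 'I_n -> R) u :
  aff_eval (phi \o f) (phi \o xi) u =
  (phi (aff_eval f xi u).1, phi (aff_eval f xi u).2).
Proof.
apply/esym; pose g v := (phi (aff_eval f xi v).1, phi (aff_eval f xi v).2).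
rewrite -/(g u); apply: aff_eval_unique => [j|v w|v w]; rewrite /g.
- by rewrite aff_eval_gen.
- by rewrite aff_evalB /= !rmorphB.
- by rewrite aff_eval_br /aff_br /= rmorphB !rmorphM rmorph0.
Qed.

Definition kdelta (R : nzRingType) i j : R := (j == i)%:R.

Definition aff_trace i : free_lie n -> symalg n * symalg n :=
  aff_eval (kdelta _ i) (fun j => 'X_j).

Lemma aff_trace_gen i j : aff_trace i (flgen j) = (kdelta _ i j, 'X_j).
Proof. exact: aff_eval_gen. Qed.

Lemma aff_trace_br i u v :
  aff_trace i (flbr u v) = aff_br (aff_trace i u) (aff_trace i v).
Proof. exact: aff_eval_br. Qed.

(** Symmetrization kills commutators, and the Fox rule gives the symmetrized
    contraction of a commutator; together these are the bracket of the affine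
    Lie algebra over the symmetric algebra. *)
Lemma symproj_contract_embed i u :
  symproj (contract i (embed u)) = (aff_trace i u).1.
Proof.
pose g u := (symproj (contract i (embed u)), symproj (embed u)).
rewrite /aff_trace -(@aff_eval_unique _ _ _ g) //.
- move=> j; rewrite /g embed_gen /contract word_ext_word /symproj.
  rewrite !word_ext_word big_seq1 /kdelta.
  case: eqP => _; rewrite ?mulr1n ?mulr0n.
    by rewrite word_ext_word big_nil.
  by rewrite -(subrr 0) word_extB subrr.
- by move=> v w; rewrite /g embedB contractB !symprojB.
- move=> v w; rewrite /g embed_br.
  rewrite (commutator_eq0 _ _ (@symprojB n) (@symprojM n)).
  congr (_, _); apply: fox_derivative_commutator; last exact: augment_embed.
  + exact: contractB.
  + exact: symprojB.
  + exact: symprojM.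
  + exact: contractM.
  + exact: augment_embed.
Qed.

Lemma morita_traceE (c : dual_lie n) :
  morita_trace c = \sum_i (aff_trace i (c i)).1.
Proof. by apply: eq_bigr => i _; exact: symproj_contract_embed. Qed.

Lemma morita_traceB : {morph @morita_trace n : c d / c - d}.
Proof.
move=> c d; rewrite !morita_traceE -sumrB; apply: eq_bigr => i _.
by rewrite !ffunE /aff_trace aff_evalB.
Qed.

Lemma morita_trace0 : morita_trace (0 : dual_lie n) = 0.
Proof. by rewrite -(subrr 0) morita_traceB subrr. Qed.

Lemma morita_traceD : {morph @morita_trace n : c d / c + d}.
Proof.
move=> c d; rewrite -[d in LHS]opprK -[- d]sub0r !morita_traceB morita_trace0.
by rewrite sub0r opprK.
Qed.

Lemma morita_trace_pure i u :
  morita_trace (pure_tensor i u) = (aff_trace i u).1.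
Proof.
rewrite morita_traceE (bigD1 i) //= ffunE eqxx big1 ?addr0 // => j ji.
by rewrite ffunE (negbTE ji) /aff_trace aff_eval0.
Qed.

End AffineMorphism.

(** * Weights and left-normed brackets *)

Section Weight.
Variable n : nat.
Implicit Types (u v w : free_lie n) (a i : 'I_n) (s : seq 'I_n).

Let flP := @flbr_is_lie n.

Lemma lbracket_rcons s i : s != [::] ->
  lbracket (map (@flgen n) (rcons s i)) =
  flbr (lbracket (map (@flgen n) s)) (flgen i).
Proof. by case: s => // a s _; rewrite /= map_rcons foldl_rcons. Qed.

Lemma lie_weight_word s :
  lie_weight (size s) (lbracket (map (@flgen n) s)).
Proof. by apply: zspan_gen; exists (in_tuple s). Qed.

Lemma lie_weight_ind (k : nat) (Q : free_lie n -> Prop) :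
  Q 0 -> (forall u v, Q u -> Q v -> Q (u - v)) ->
  (forall s, size s = k -> Q (lbracket (map (@flgen n) s))) ->
  forall u, lie_weight k u -> Q u.
Proof.
move=> Q0 QB Qs u; elim=> // [v [j ->]|v w _ Qv _ Qw]; last exact: QB.
by apply: Qs; rewrite size_tuple.
Qed.

Lemma lie_weight_gen a : lie_weight 1 (flgen a).
Proof. exact: (lie_weight_word [:: a]). Qed.

Lemma lie_weight_brgen k u a :
  lie_weight k u -> lie_weight k.+1 (flbr u (flgen a)).
Proof.
elim/lie_weight_ind => [|v w wv ww|s <-].
- by rewrite (lie_br0l flP); exact: zspan_0.
- by rewrite (lie_brBl flP); exact: zspan_B.
- case: s => [|b s]; first by rewrite (lie_br0l flP); exact: zspan_0.
  by rewrite -lbracket_rcons // -(size_rcons _ a); exact: lie_weight_word.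
Qed.

(** Jacobi moves the letters of a left-normed second factor one by one to the
    outside: [u, [v, x]] = [[u, v], x] - [[u, x], v]. *)
Lemma lie_weight_br p q u v :
  lie_weight p u -> lie_weight q v -> lie_weight (p + q) (flbr u v).
Proof.
move=> wu wv; elim/lie_weight_ind: v / wv => [|v w wv ww|s <-].
- by rewrite (lie_br0r flP); exact: zspan_0.
- by rewrite (lie_brBr flP); exact: zspan_B.
elim/last_ind: s p u wu => [|s i IH] p u wu.
  by rewrite (lie_br0r flP); exact: zspan_0.
have [->|s0] := eqVneq s [::].
  by rewrite addn1; exact: lie_weight_brgen.
rewrite lbracket_rcons // (lie_br_derivation flP) size_rcons addnS.
apply: zspan_B; first exact/lie_weight_brgen/IH.
by rewrite -addSn; exact/IH/lie_weight_brgen.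
Qed.

Lemma pure_tensorB i : {morph @pure_tensor n i : u v / u - v}.
Proof.
by move=> u v; apply/ffunP => l; rewrite !ffunE; case: eqP; rewrite ?subr0.
Qed.

Lemma sum_pure_tensor i u : \sum_l pure_tensor i u l = u.
Proof.
rewrite (bigD1 i) //= ffunE eqxx big1 ?addr0 // => j /negbTE ji.
by rewrite ffunE ji.
Qed.

Lemma p_mod_pure k i u : (0 < k)%N ->
  lie_weight k u -> p_mod k (pure_tensor i (flbr u (flgen i))).
Proof.
move=> k0; elim/lie_weight_ind => [|v w pv pw|s sk].
- rewrite (lie_br0l flP) -(subrr 0) pure_tensorB subrr; exact: zspan_0.
- by rewrite (lie_brBl flP) pure_tensorB; exact: zspan_B.
- have s0 : s != [::] by rewrite -size_eq0 sk -lt0n.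
  rewrite -lbracket_rcons //; apply: zspan_gen.
  by move/eqP: sk => sk; exists i, (Tuple sk).
Qed.

(** The left-normed bracket [a, s_m, ..., s_1], with [s] read backwards so that
    the outermost letter is at the head. *)
Definition left_normed a s : free_lie n :=
  foldr (fun y u => flbr u (flgen y)) (flgen a) s.

Lemma left_normed_weight a s : lie_weight (size s).+1 (left_normed a s).
Proof.
by elim: s => [|y s IH] /=; [exact: lie_weight_gen | exact: lie_weight_brgen].
Qed.

Lemma aff_trace_left_normed2 i a b s :
  (aff_trace i (left_normed a (rcons s b))).2 = 0.
Proof. by case: s => [|y s]; rewrite /= aff_trace_br. Qed.

(** Bracketing with one more letter only multiplies by it, so the contraction
    sees the two innermost letters. *)
Lemma aff_trace_left_normed1 i a b s :
  (aff_trace i (left_normed a (rcons s b))).1 =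
  (kdelta _ i a * 'X_b - kdelta _ i b * 'X_a) * \prod_(y <- s) 'X_y.
Proof.
elim: s => [|y s IH].
  by rewrite /= aff_trace_br !aff_trace_gen big_nil mulr1.
rewrite rcons_cons /= aff_trace_br /aff_br /= IH aff_trace_gen /= big_cons.
by rewrite aff_trace_left_normed2 mulr0 subr0 -mulrA [_ * 'X_y]mulrC.
Qed.

End Weight.

(** * Tree elements in the kernel of the sum *)

Section Trees.
Variable n : nat.
Implicit Types (u v w : free_lie n) (a b c d : 'I_n) (s : seq 'I_n).

Let flP := @flbr_is_lie n.

(** Glue the tree of [left_normed a s] to a Lie element [w] along their roots.
    This is the sum, over the leaves l of the first tree only, of
    x_l^* (x) [T_l, x_l] with T_l the glued tree rooted at l. Moving the root
    into the factor left_normed a s of [left_normed a s, y] turns [w] into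
    [y, w]; moving it to the leaf y gives the bracket [w, left_normed a s]. *)
Fixpoint leaf_sum a s w : dual_lie n :=
  if s is y :: s' then
    leaf_sum a s' (flbr (flgen y) w)
    + pure_tensor y (flbr (flbr w (left_normed a s')) (flgen y))
  else pure_tensor a (flbr w (flgen a)).

(** Each induction step is one Jacobi identity. *)
Lemma sum_leaf_sum a s w : \sum_i leaf_sum a s w i = flbr w (left_normed a s).
Proof.
elim: s w => [|y s IH] w /=; first exact: sum_pure_tensor.
under eq_bigr do rewrite ffunE.
rewrite big_split /= IH sum_pure_tensor.
rewrite (lie_br_derivation flP) (lie_brC flP (flgen y) w).
rewrite -[- flbr w _]sub0r (lie_brBl flP) (lie_br0l flP) sub0r.
by rewrite addrC.
Qed.

Lemma p_mod_leaf_sum k a s w : (0 < k)%N ->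
  lie_weight k w -> p_mod (k + size s) (leaf_sum a s w).
Proof.
elim: s k w => [|y s IH] k w k0 wk /=.
  by rewrite addn0; exact: p_mod_pure.
rewrite addnS -addSn; apply: zspanD.
  apply: IH => //; rewrite -add1n.
  by apply: lie_weight_br => //; exact: lie_weight_gen.
apply: p_mod_pure => //; rewrite addSn -addnS.
by apply: lie_weight_br => //; exact: left_normed_weight.
Qed.

(** The sum over all the leaves of the tree of [left_normed a s] with its root
    labelled by [d]. *)
Definition caterpillar a s d : dual_lie n :=
  pure_tensor d (flbr (left_normed a s) (flgen d)) + leaf_sum a s (flgen d).

(** The two sides of the edge at [d] contribute [u, x_d] and [x_d, u]. *)
Lemma b_mod_caterpillar a s d : b_mod (size s).+1 (caterpillar a s d).
Proof.
split.
  apply: zspanD; first by apply: p_mod_pure => //; exact: left_normed_weight.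
  by rewrite -add1n; apply: p_mod_leaf_sum => //; exact: lie_weight_gen.
under eq_bigr do rewrite ffunE.
rewrite big_split /= sum_pure_tensor sum_leaf_sum (lie_brC flP (flgen d)).
exact: subrr.
Qed.

(** Once [w] is a bracket, its symmetrization vanishes; a leaf [y] of [s] then
    separates two brackets and contributes nothing. Only the two end leaves
    [a] and [b] remain, with a sign for each letter of [s] that the root
    crosses. *)
Lemma morita_trace_leaf_sum a b s w : (forall i, (aff_trace i w).2 = 0) ->
  morita_trace (leaf_sum a (rcons s b) w) =
  (-1) ^+ size s * (\prod_(y <- s) 'X_y) * ('X_a * 'X_b)
    * ((aff_trace b w).1 - (aff_trace a w).1).
Proof.
elim: s w => [|y s IH] w w0.
  rewrite /= morita_traceD !morita_trace_pure !aff_trace_br /aff_br /=.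
  by rewrite !aff_trace_gen /= !w0 big_nil; ring.
rewrite rcons_cons /= morita_traceD IH => [|i]; last by rewrite aff_trace_br.
rewrite morita_trace_pure !aff_trace_br /aff_br /= !aff_trace_gen /= !w0.
by rewrite aff_trace_left_normed2 big_cons exprS; ring.
Qed.

(** The caterpillar with end pairs {a, b} and {c, a}. For an even number of
    middle letters the paths between the two ends have the same sign in both
    directions, whence the factor 2. *)
Lemma morita_trace_caterpillar a b c s :
  ~~ odd (size s) -> a != b -> c != a ->
  morita_trace (caterpillar a (c :: rcons s b) a) =
  ('X_a * 'X_b * (\prod_(y <- s) 'X_y)
     * ('X_c + kdelta _ b c * 'X_a)) *+ 2.
Proof.
move=> even_s ab ca; rewrite /caterpillar morita_traceD morita_trace_pure.
rewrite [leaf_sum _ _ _]/= morita_traceD morita_trace_leaf_sum; last first.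
  by move=> i; rewrite aff_trace_br.
rewrite morita_trace_pure !aff_trace_br /aff_br /= !aff_trace_gen /=.
rewrite !aff_trace_left_normed2 !aff_trace_left_normed1 /=.
rewrite -signr_odd (negbTE even_s) expr0 /kdelta !eqxx.
rewrite (eq_sym b a) (negbTE ab) (negbTE ca) (eq_sym a c) (negbTE ca).
by case: (eqVneq c b) => [->|cb]; rewrite mulr2n !(mulr1n, mulr0n); ring.
Qed.

End Trees.

(** * Constraints on the image *)

Section Constraints.
Variable n : nat.
Implicit Types (u v w : free_lie n) (a b i : 'I_n) (s : seq 'I_n).
Implicit Types (q : symalg n).

Lemma image_MTB0 k : image_MTB k (0 : symalg n).
Proof.
exists 0; last by rewrite morita_trace0.
by split; [exact: zspan_0 | rewrite big1 // => i _; rewrite ffunE].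
Qed.

Lemma image_MTBB k q1 q2 :
  image_MTB k q1 -> image_MTB k q2 -> image_MTB k (q1 - q2).
Proof.
move=> [c [pc c0] ->] [d [pd d0] ->].
exists (c - d); last by rewrite morita_traceB.
split; first exact: zspan_B.
under eq_bigr do rewrite !ffunE.
by rewrite sumrB c0 d0 subrr.
Qed.

Lemma aff_trace_homog k i u : lie_weight k.+1 u ->
  (aff_trace i u).1 \is k.-homog /\ (aff_trace i u).2 \is k.+1.-homog.
Proof.
elim/lie_weight_ind => [|v w [hv1 hv2] [hw1 hw2]|s].
- by rewrite /aff_trace aff_eval0; split; exact: dhomog0.
- by rewrite /aff_trace aff_evalB; split; exact: rpredB.
elim/last_ind: s k => [|s x IH] k //; rewrite size_rcons => -[sk].
have [s0|s0] := eqVneq s [::].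
  rewrite s0 in sk *; rewrite -sk /= aff_trace_gen /kdelta; split => /=.
    by rewrite -mulr_natr mul1r -scaler_nat; apply: rpredZ; exact: dhomog1.
  by rewrite dhomogX /= mdeg1.
case: k sk => [/size0nil/eqP|k sk]; first by rewrite (negbTE s0).
have [h1 h2] := IH _ sk.
rewrite lbracket_rcons // aff_trace_br /aff_br aff_trace_gen /=.
split; last exact: dhomog0.
apply: rpredB.
  by rewrite -addn1; apply: dhomogM => //; rewrite dhomogX /= mdeg1.
by rewrite /kdelta mulr_natl; apply: rpredMn.
Qed.

Lemma image_MTB_homog k q : image_MTB k q -> q \is k.-homog.
Proof.
move=> [c [pc _] ->]; rewrite morita_traceE; apply: rpred_sum => i _.
by have [] := aff_trace_homog i (p_mod_weight pc i).
Qed.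

Lemma aff_trace_eval xi i u :
  (aff_trace i u).1.@[xi] = (aff_eval (kdelta int i) xi u).1.
Proof.
pose phi : {rmorphism symalg n -> int} := meval xi.
have := aff_eval_rmorph phi (kdelta _ i) (fun j : 'I_n => 'X_j) u.
rewrite (_ : phi \o kdelta _ i = kdelta int i); last first.
  by apply: funext => j; rewrite /= /kdelta rmorph_nat.
rewrite (_ : phi \o _ = xi); last by apply: funext => j; rewrite /= mevalXU.
by move=> ->.
Qed.

(** The point e_b - e_a, replaced by e_a when a = b: the evaluations at these
    points are independent functionals that vanish on the image. *)
Definition pair_point a b : 'I_n -> int :=
  fun j => (j == b)%:R - ((a != b) && (j == a))%:R.

(** The morphisms that compute the traces of the components depend on the index
    i, but at such a point the one for i = b serves for all of them. *)
Lemma morita_trace_pair_point k a b (c : dual_lie n) :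
  (2 <= k)%N -> p_mod k c ->
  (morita_trace c).@[pair_point a b] =
  (aff_eval (kdelta int b) (pair_point a b) (\sum_i c i)).1.
Proof.
move=> k2; elim => [{}c [i [j ->]]||c1 c2 _ IH1 _ IH2]; last 1 first.
- rewrite morita_traceB mevalB IH1 IH2.
  under [in RHS]eq_bigr do rewrite !ffunE.
  by rewrite sumrB aff_evalB.
- rewrite morita_trace_pure sum_pure_tensor aff_trace_eval.
  rewrite lbracket_rcons; last by rewrite -size_eq0 size_tuple; case: k k2 j.
  set u := lbracket _.
  have u2 f : (aff_eval f (pair_point a b) u).2 = 0.
    rewrite /u; case: j {u} => s /= /eqP sk; rewrite -sk in k2.
    elim/last_ind: s k2 {sk} => // s x _; rewrite size_rcons ltnS => s0.
    by rewrite lbracket_rcons ?aff_eval_br // -size_eq0 -lt0n.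
  rewrite !aff_eval_br /aff_br !aff_eval_gen /= !u2 !mulr0 !subr0.
  (* The coordinate of the point vanishes unless i is a or b; for i = a the
     two values agree because delta_a = delta_b - xi_ab. *)
  have [->//|ib] := eqVneq i b.
  have [iab|iab] := boolP ((a != b) && (i == a)); last first.
    by rewrite /pair_point (negbTE ib) (negbTE iab) subrr !mulr0.
  case/andP: iab => ab /eqP ia; subst i; congr (_ * _).
  have -> : kdelta int a =
      (fun l => kdelta int b l + (-1) * pair_point a b l).
    by apply: funext => l; rewrite /kdelta /pair_point ab /=; ring.
  by rewrite aff_eval_shear u2 mulr0 addr0.
- rewrite big1 => [|i _]; last by rewrite ffunE.
  by rewrite aff_eval0 morita_trace0 meval0.
Qed.

Lemma image_MTB_pair_point k a b q : (2 <= k)%N -> image_MTB k q ->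
  q.@[pair_point a b] = 0.
Proof.
move=> k2 [c [pc c0] ->].
by rewrite (morita_trace_pair_point _ _ k2 pc) c0 aff_eval0.
Qed.

End Constraints.

(** * Pivot monomials *)

Section Pivots.
Variable n : nat.
Implicit Types (a b c d i : 'I_n) (m : 'X_{1..n}) (q : symalg n).

Definition pivot k a b : 'X_{1..n} := (U_(a) *+ k.-1 + U_(b))%MM.

Definition is_pivot k m : bool :=
  [exists a : 'I_n, exists b : 'I_n, (a <= b)%N && (m == pivot k a b)].

Lemma pivotP k m :
  reflect (exists a b, (a <= b)%N /\ m = pivot k a b) (is_pivot k m).
Proof.
apply: (iffP existsP) => [[a /existsP[b /andP[ab /eqP->]]]|[a [b [ab ->]]]].
  by exists a, b.
by exists a; apply/existsP; exists b; rewrite ab eqxx.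
Qed.

Lemma pivot_inj k a b c d : (3 <= k)%N ->
  pivot k a b = pivot k c d -> a = c /\ b = d.
Proof.
move=> k3 /mnmP e.
have ac : a = c.
  apply/eqP; have := e a; rewrite !mnmDE !mulmnE !mnm1E eqxx.
  by case: (eqVneq c a) => // _; lia.
split=> //; have := e b; rewrite ac !mnmDE !mulmnE !mnm1E eqxx.
by case: (eqVneq d b) => [->|_] //; lia.
Qed.

(** The system of the conditions q(xi_ab) = 0 is triangular in the coefficients
    at the pivots: xi_aa sees only x_a^k, and, for a < b, xi_ab sees only
    x_a^k, x_b^k and x_a^(k-1) x_b. *)
Lemma pivot_in_image_eq0 k q : (3 <= k)%N -> image_MTB k q ->
  (forall m, mdeg m = k -> ~~ is_pivot k m -> q@_m = 0) -> q = 0.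
Proof.
move=> k3 imq qN.
have q_homog := image_MTB_homog imq.
have supp_pivot m :
    m \in msupp q -> exists c d, (c <= d)%N /\ m = pivot k c d.
  move=> mq; apply/pivotP; apply: contraTT mq => mN.
  rewrite -mcoeff_eq0; apply/eqP.
  have [mk|mk] := eqVneq (mdeg m) k; first exact: qN.
  exact: dhomog_nemf_coeff q_homog mk.
have pivot_eval a b c d :
    (pair_point a b c == 0) || (pair_point a b d == 0) ->
    \prod_i pair_point a b i ^+ pivot k c d i = 0.
  move=> /orP[/eqP cd|/eqP cd].
    rewrite (bigD1 c) //= cd mnmDE mulmnE mnm1E eqxx expr0n.
    by rewrite (_ : (_ + _ == 0)%N = false) ?mul0r //; lia.
  by rewrite (bigD1 d) //= cd mnmDE [in _^+_]mnm1E eqxx expr0n addn1 mul0r.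
have pivot_coef0 a b : (forall c d, (c <= d)%N -> pivot k c d \in msupp q ->
      pivot k c d != pivot k a b ->
      (pair_point a b c == 0) || (pair_point a b d == 0)) ->
    q@_(pivot k a b) = 0.
  move=> others; have := image_MTB_pair_point a b (ltnW k3) imq.
  have [pq|] := boolP (pivot k a b \in msupp q); last first.
    by rewrite -mcoeff_eq0 => /eqP.
  rewrite mevalE (bigD1_seq (pivot k a b)) ?msupp_uniq //=.
  rewrite [X in _ + X]big1_seq ?addr0.
    move=> /eqP; rewrite mulf_eq0 => /orP[/eqP//|].
    apply: contraTeq => _; apply/prodf_neq0 => i _.
    rewrite /pair_point mnmDE mulmnE !mnm1E.
    rewrite !(eq_sym i); have [bi|bi] := eqVneq b i.
      rewrite (_ : _ && _ = false) ?subr0 ?expr1n //.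
      by rewrite bi; case: eqVneq.
    have [ai|ai] := eqVneq a i; last by rewrite expr0.
    by rewrite ai (eq_sym i) (negbTE bi) sub0r expf_neq0.
  move=> m /andP[mN mq]; have [c [d [cd mE]]] := supp_pivot _ mq; subst m.
  by rewrite pivot_eval ?mulr0 //; exact: others.
have diag0 a : q@_(pivot k a a) = 0.
  apply: pivot_coef0 => c d _ _ cdN; rewrite /pair_point eqxx /= !subr0.
  case: (eqVneq c a) cdN => //= ->; case: (eqVneq d a) => // ->.
  by rewrite eqxx.
apply/mpolyP => m; rewrite mcoeff0; apply/eqP; rewrite mcoeff_eq0.
apply/negP => mq; have [a [b [ab mE]]] := supp_pivot _ mq; subst m.
suff /eqP : q@_(pivot k a b) = 0 by rewrite mcoeff_eq0 mq.
have [<-|aNb] := eqVneq a b; first exact: diag0.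
apply: pivot_coef0 => c d cd cdq cdN; rewrite /pair_point aNb /=.
have cNd : c != d.
  by apply: contraTneq cdq => ->; rewrite -mcoeff_eq0 diag0.
case: (eqVneq c a) cdN cNd => [->|ca] cdN cNd.
  have db : d != b by apply: contraNneq cdN => ->.
  by rewrite (negbTE db) (eq_sym d) (negbTE cNd) subrr orbT.
have [cb|cb] := eqVneq c b; last by rewrite subrr.
have da : d != a.
  apply: contraNneq cNd => da; apply/eqP/val_inj/eqP.
  by rewrite /= eqn_leq cd da cb ab.
by rewrite -cb (eq_sym d) (negbTE cNd) (negbTE da) subrr orbT.
Qed.

Lemma card_le_pairs :
  #|[set p : 'I_n * 'I_n | (p.1 <= p.2)%N]| = 'C(n.+1, 2).
Proof.
rewrite -sum1_card big_mkcond /=.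
rewrite (eq_bigr (fun p : 'I_n * 'I_n => ((p.1 <= p.2)%N : nat))); last first.
  by move=> p _; rewrite inE; case: leqP.
rewrite -(pair_bigA _ (fun a b : 'I_n => ((a <= b)%N : nat))) exchange_big /=.
rewrite -bin2_sum big_nat_recl // add0n big_mkord; apply: eq_bigr => b _.
rewrite (eq_bigr (fun a : 'I_n => if (a < b.+1)%N then 1%N else 0%N)).
  by rewrite -big_mkcond (big_ord_narrow (ltn_ord b)) sum1_card card_ord.
by move=> a _; rewrite ltnS; case: leqP.
Qed.

Definition nonpivots k : seq 'X_{1..n} :=
  [seq m <- [seq s2m (val t) | t <- enum (basis n k)] | ~~ is_pivot k m].

Lemma mem_nonpivots k m :
  (m \in nonpivots k) = ~~ is_pivot k m && (mdeg m == k).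
Proof. by rewrite mem_filter basis_cover. Qed.

Lemma nonpivots_uniq k : uniq (nonpivots k).
Proof. exact/filter_uniq/uniq_basis. Qed.

Lemma size_nonpivots k : (0 < n)%N -> (3 <= k)%N ->
  size (nonpivots k) = ('C(n + k - 1, k) - (n * (n + 1)) %/ 2)%N.
Proof.
move=> n0 k3; set B := [seq s2m (val t) | t <- enum (basis n k)].
have szB : size B = 'C(n + k - 1, k).
  rewrite /B; case: n n0 => // n' _.
  by rewrite size_basis; congr 'C(_, _); lia.
have szP : size (filter (is_pivot k) B) = 'C(n.+1, 2).
  rewrite -card_le_pairs cardE -(size_map (fun p => pivot k p.1 p.2)).
  apply: perm_size; apply: uniq_perm.
  - exact/filter_uniq/uniq_basis.
  - rewrite map_inj_in_uniq ?enum_uniq // => -[a b] [c d] _ _ /=.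
    by case/(pivot_inj k3) => -> ->.
  move=> m; rewrite mem_filter -basis_cover; apply/andP/mapP.
    case=> /pivotP[a [b [ab ->]]] _; exists (a, b) => //.
    by rewrite mem_enum inE.
  case=> -[a b]; rewrite mem_enum inE /= => ab ->; split.
    by apply/pivotP; exists a, b.
  by rewrite /pivot mdegD mdegMn !mdeg1; lia.
have := count_predC (is_pivot k) B.
rewrite -!size_filter szP szB => <-.
by rewrite /nonpivots -/B bin2 mulnC addn1 divn2 addnC addnK.
Qed.

End Pivots.

(** * Elements of the image *)

Section Elements.
Variable n : nat.
Implicit Types (a b c i : 'I_n) (m : 'X_{1..n}) (q : symalg n).

Lemma prod_m2s m : \prod_(y <- m2s m) 'X_y = 'X_[m] :> symalg n.
Proof.
rewrite /m2s big_flatten big_map mpolyXE_id big_enum /=.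
by apply: eq_bigr => i _; rewrite big_nseq iter_mulr_1.
Qed.

Lemma image_MTB_caterpillar k a b c m :
  odd k -> a != b -> c != a -> (mdeg m + 3 = k)%N ->
  image_MTB k (('X_[m + U_(a) + U_(b) + U_(c)]
     + kdelta _ b c * 'X_[m + U_(a) + U_(b) + U_(a)]) *+ 2 : symalg n).
Proof.
move=> k_odd ab ca mk.
exists (caterpillar a (c :: rcons (m2s m) b) a).
  have -> : k = (size (c :: rcons (m2s m) b)).+1.
    by rewrite /= size_rcons size_m2s -mk addn3.
  exact: b_mod_caterpillar.
rewrite morita_trace_caterpillar // ?prod_m2s ?mpolyXD.
  by congr (_ *+ _); ring.
by rewrite size_m2s; move: k_odd; rewrite -mk oddD addbT.
Qed.

Lemma image_MTB_three_variables k a b c m :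
  odd k -> mdeg m = k -> a != b -> b != c -> c != a ->
  (0 < m a)%N -> (0 < m b)%N -> (0 < m c)%N ->
  image_MTB k ('X_[m] *+ 2 : symalg n).
Proof.
move=> k_odd mk ab bc ca ma mb mc.
have le : (U_(a) + U_(b) + U_(c) <= m)%MM.
  apply/mnm_lepP => i; rewrite !mnmDE !mnm1E.
  case: (eqVneq a i) => [<-|_].
    by rewrite eq_sym (negbTE ab) (negbTE ca).
  case: (eqVneq b i) => [<-|_]; first by rewrite eq_sym (negbTE bc).
  by case: (eqVneq c i) => [<-|_].
have := @image_MTB_caterpillar k a b c
          (m - (U_(a) + U_(b) + U_(c)))%MM k_odd ab ca.
rewrite -!addmA addmA submK // /kdelta eq_sym (negbTE bc) mul0r addr0.
by apply; rewrite -mk -[in RHS](submK le) mdegD !mdegD !mdeg1; lia.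
Qed.

Definition mono2 a b s t : 'X_{1..n} := (U_(a) *+ s + U_(b) *+ t)%MM.

Lemma mono2E a b s t i : mono2 a b s t i = ((a == i) * s + (b == i) * t)%N.
Proof. by rewrite mnmDE !mulmnE !mnm1E. Qed.

Lemma mdeg_mono2 a b s t : mdeg (mono2 a b s t) = (s + t)%N.
Proof. by rewrite mdegD !mdegMn !mdeg1 !mul1n. Qed.

Lemma mono2_support a b m : a != b ->
  (forall c, c != a -> c != b -> m c = 0%N) -> m = mono2 a b (m a) (m b).
Proof.
move=> ab m0; apply/mnmP => i; rewrite mono2E.
have [ia|ia] := eqVneq i a; first by rewrite ia (eq_sym b) (negbTE ab); lia.
have [ib|ib] := eqVneq i b; first by rewrite ib; lia.
by rewrite (m0 i ia ib).
Qed.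

Lemma image_MTB_two_variables k a b s t :
  odd k -> a != b -> (s + t + 3 = k)%N ->
  image_MTB k (('X_[mono2 a b s.+1 t.+2]
     + 'X_[mono2 a b s.+2 t.+1]) *+ 2 : symalg n).
Proof.
move=> k_odd ab stk.
have := @image_MTB_caterpillar k a b b (mono2 a b s t) k_odd ab.
rewrite eq_sym ab /kdelta eqxx mul1r => /(_ isT).
have -> : (mono2 a b s t + U_(a) + U_(b) + U_(b))%MM = mono2 a b s.+1 t.+2.
  by apply/mnmP => i; rewrite !(mono2E, mnmDE, mnm1E); lia.
have -> : (mono2 a b s t + U_(a) + U_(b) + U_(a))%MM = mono2 a b s.+2 t.+1.
  by apply/mnmP => i; rewrite !(mono2E, mnmDE, mnm1E); lia.
by apply; rewrite mdeg_mono2.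
Qed.

(** Telescoping down to t = 0, where the monomial x_a^(k-1) x_b is a pivot and
    the zero element will do. *)
Lemma image_MTB_mono2 k a b s t : odd k -> (a < b)%N -> (s + t + 2 = k)%N ->
  exists2 q : symalg n, image_MTB k q &
    forall m, ~~ is_pivot k m -> q@_m = (mono2 a b s.+1 t.+1 == m)%:R *+ 2.
Proof.
move=> k_odd ab; elim: t s => [|t IH] s stk.
  exists 0 => [|m mN]; first exact: image_MTB0.
  rewrite mcoeff0 (_ : (_ == m) = false) ?mul0rn //.
  apply: contraNF mN => /eqP <-; apply/pivotP; exists a, b.
  split; first exact: ltnW.
  by rewrite /mono2 /pivot mulm1n; congr (_ *+ _ + _)%MM; lia.
have [q imq qm] := IH s.+1 ltac:(lia).
have aNb : a != b by rewrite neq_ltn ab.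
exists (('X_[mono2 a b s.+1 t.+2] + 'X_[mono2 a b s.+2 t.+1]) *+ 2 - q).
  by apply: image_MTBB => //; apply: image_MTB_two_variables => //; lia.
move=> m mN; rewrite mcoeffB mcoeffMn mcoeffD !mcoeffX qm //.
by rewrite mulrnDl addrK.
Qed.

(** A monomial that is not a pivot involves at least two variables; with three
    or more it is in the image up to the factor 2, with exactly two the
    telescoping applies. *)
Lemma image_MTB_twice_monomial k m :
  odd k -> (3 <= k)%N -> mdeg m = k -> ~~ is_pivot k m ->
  exists2 q : symalg n, image_MTB k q &
    forall m', ~~ is_pivot k m' -> q@_m' = (m == m')%:R *+ 2.
Proof.
move=> k_odd k3 mk mN.
have [a ma] : exists a, (0 < m a)%N.
  apply/existsP; rewrite -[X in is_true X]negbK negb_exists.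
  apply/negP => /forallP m0.
  have m_eq0 : m = 0%MM.
    by apply/mnmP => i; rewrite mnm0E; move: (m0 i); lia.
  by move: k3; rewrite -mk m_eq0 mdeg0.
have [b bNa mb] : exists2 b, b != a & (0 < m b)%N.
  have [/existsP[b /andP[ba mb]]|] :=
      boolP [exists b, (b != a) && (0 < m b)%N].
    by exists b.
  rewrite negb_exists => /forallP m0.
  have mE : m = (U_(a) *+ m a)%MM.
    apply/mnmP => i; rewrite mulmnE mnm1E.
    have [<-|ai] := eqVneq a i; first by lia.
    by move: (m0 i); rewrite eq_sym ai; lia.
  case/negP: mN; apply/pivotP; exists a, a; split=> //.
  move: mk; rewrite {1}mE mdegMn mdeg1 mul1n => mak.
  by rewrite mE mak /pivot -mulmSr prednK //; lia.
have [/existsP[c /and3P[ca cb mc]]|] :=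
    boolP [exists c, [&& c != a, c != b & (0 < m c)%N]].
  exists ('X_[m] *+ 2) => [|m' _]; last by rewrite mcoeffMn mcoeffX.
  by apply: (@image_MTB_three_variables _ a b c) => //; rewrite eq_sym.
rewrite negb_exists => /forallP m0.
have {}m0 c : c != a -> c != b -> m c = 0%N.
  by move=> ca cb; move: (m0 c); rewrite ca cb; lia.
have main (x y : 'I_n) :
    (x < y)%N -> (0 < m x)%N -> (0 < m y)%N -> m = mono2 x y (m x) (m y) ->
    exists2 q : symalg n, image_MTB k q &
      forall m', ~~ is_pivot k m' -> q@_m' = (m == m')%:R *+ 2.
  move=> xy mx my mE.
  have := @image_MTB_mono2 k x y (m x).-1 (m y).-1 k_odd xy.
  rewrite !prednK // -mE; apply.
  by move: mk; rewrite {1}mE mdeg_mono2; lia.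
have [ab|ba|/val_inj ab] := ltngtP a b.
- by apply: (main a b) => //; apply: mono2_support; rewrite // eq_sym.
- by apply: (main b a) => //; apply: mono2_support => // c cb ca; exact: m0.
- by rewrite ab eqxx in bNa.
Qed.

End Elements.

Theorem theorem1 (n k : nat) (hn : (3 <= n)%N) (hk : (3 <= k)%N) (k_odd : odd k) :
  has_zrank (@image_MTB n k) ('C(n + k - 1, k) - (n * (n + 1)) %/ 2)%N.
Proof.
rewrite -size_nonpivots //; last exact: ltnW (ltnW hn).
pose mon i := nth 0%MM (nonpivots n k) i.
have monP i : (i < size (nonpivots n k))%N ->
    ~~ is_pivot k (mon i) /\ mdeg (mon i) = k.
  by move=> /(mem_nth 0%MM); rewrite mem_nonpivots => /andP[? /eqP].
pose coord (i : 'I_(size (nonpivots n k))) : {additive symalg n -> int} :=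
  mpoly.mcoeff (mon i).
apply: (has_zrank_coordinates (coord := coord)).
- exact: image_MTB0.
- exact: image_MTBB.
- move=> q imq q0; apply: (pivot_in_image_eq0 hk imq) => m mk mN.
  have mB : m \in nonpivots n k by rewrite mem_nonpivots mN mk eqxx.
  have ltm : (index m (nonpivots n k) < size (nonpivots n k))%N.
    by rewrite index_mem.
  by have := q0 (Ordinal ltm); rewrite /coord /mon /= nth_index.
- move=> i; have [iN ik] := monP _ (ltn_ord i).
  have [q imq qm] := image_MTB_twice_monomial k_odd hk ik iN.
  exists q => //; split=> [|j ji]; first by rewrite /coord /= qm // eqxx.
  have [jN _] := monP _ (ltn_ord j).
  rewrite /coord /= qm // nth_uniq ?nonpivots_uniq //.
  by rewrite (inj_eq (@ord_inj _)) eq_sym (negbTE ji) mul0rn.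
Qed.
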